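(* Let $(M,\omega)$ be a symplectic manifold. Let $f,g,h\in C^{\infty}(M)$, and let $f_1,f_2,\ldots$ and $g_1,g_2,\ldots$ be sequences in $C^{\infty}(M)$ such that $f_n\to f$, $g_n\to g$ and $\{f_n,g_n\}\to h$ uniformly on $M$. Let $\rho$ be any Riemannian metric on $M$. If $$\max\big(\|f_n-f\|_U,\|g_n-g\|_U\big)\,\|g_n\|_{U,1}\longrightarrow 0\quad\text{as }n\to\infty$$ for every open $U\subset M$ with compact closure, then $\{f,g\}=h$. (The condition that $\max\big(\|f_n-f\|_U,\|g_n-g\|_U\big)\,\|g_n\|_{U,1}\to 0$ as $n\to\infty$ for every open $U\subset M$ with compact closure does not depend on the choice of the metric $\rho$.)
   Context: For $H\in C^\infty(M)$ the Hamiltonian vector field $X_H$ is defined by $\omega(X_H,\cdot)=dH$ (the sign convention is immaterial), and $\{f,g\}=df(X_g)$. For a function $k$, $\|k\|_U:=\sup_{x\in U}|k(x)|$. With respect to $\rho$, $\|k\|_{x,1}:=\max_{v\in T_xM,\ \|v\|_\rho=1}|dk_x(v)|$ and $\|k\|_{U,1}:=\sup_{x\in U}\|k\|_{x,1}$. *)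

(* Defs.v *)
From mathcomp Require Import all_boot all_order all_algebra.
From mathcomp Require Import all_classical all_reals all_analysis.
Import Order.TTheory GRing.Theory Num.Theory.
Import numFieldNormedType.Exports.

Set Implicit Arguments.
Unset Strict Implicit.
Unset Printing Implicit Defensive.

Local Open Scope classical_set_scope.
Local Open Scope ring_scope.

(* Written for MathComp-Analysis, over an arbitrary [R : realType]. *)

(* [C^n] on an open set [A] of a finite-dimensional space: [f] is
   differentiable on [A] with a [C^(n-1)] derivative, i.e. all directional
   derivatives are [C^(n-1)].  Both conditions are local, so the values of [f]
   outside the open set [A] are irrelevant. *)
Fixpoint Cn_on (R : realType) (V W : normedModType R) (n : nat)
    (A : set V) (f : V -> W) : Prop :=
  match n with
  | 0 => forall y, A y -> {for y, continuous f}
  | n'.+1 => (forall y, A y -> differentiable f y) /\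
             (forall v : V, Cn_on n' A ('D_v f))
  end.

Definition smooth_on (R : realType) (V W : normedModType R)
    (A : set V) (f : V -> W) : Prop := forall n, Cn_on n A f.

(* A homeomorphism between an open set of [M] and an open set of [R^d]; both
   directions are total functions, meaningful only on [dom] and [cod]. *)
Record chart (R : realType) (d : nat) (M : topologicalType) := Chart {
  dom : set M;
  cod : set 'rV[R]_d;
  chart_map : M -> 'rV[R]_d;
  chart_inv : 'rV[R]_d -> M;
  dom_open : open dom;
  cod_open : open cod;
  chart_map_cod : forall x, dom x -> cod (chart_map x);
  chart_inv_dom : forall y, cod y -> dom (chart_inv y);
  chart_mapK : forall x, dom x -> chart_inv (chart_map x) = x;
  chart_invK : forall y, cod y -> chart_map (chart_inv y) = y;
  chart_map_continuous : forall x, dom x -> {for x, continuous chart_map};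
  chart_inv_continuous : forall y, cod y -> {for y, continuous chart_inv}
}.

(* The atlas need not be maximal.  [chart_at x] is a selected chart of the
   atlas around [x]; it is only used to represent [T_x M], see [tangent]. *)
Record manifold (R : realType) (d : nat) := Manifold {
  carrier :> topologicalType;
  manifold_hausdorff : hausdorff_space carrier;
  manifold_second_countable : @second_countable carrier;
  atlas : set (chart R d carrier);
  atlas_smooth : forall c c', atlas c -> atlas c' ->
    smooth_on (cod c `&` chart_inv c @^-1` dom c')
      (chart_map c' \o chart_inv c);
  chart_at : carrier -> chart R d carrier;
  chart_at_atlas : forall x, atlas (chart_at x);
  chart_at_dom : forall x, dom (chart_at x) x
}.

Section Manifold.
Context (R : realType) (d : nat) (M : manifold R d).

Definition smooth (k : M -> R) : Prop :=
  forall c, atlas c -> smooth_on (cod c) (k \o chart_inv c).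

(* A tangent vector at [x] is represented by its coordinates in [chart_at x];
   its coordinates in another chart are obtained by the differential of the
   change of charts, see [push]. *)
Definition tangent (x : M) : lmodType R := 'rV[R]_d.

(* [d(c^-1)_y u], the vector of [T_(c^-1 y) M] whose coordinates in [c]
   are [u]. *)
Definition push (c : chart R d M) (y u : 'rV[R]_d) : tangent (chart_inv c y) :=
  'd (chart_map (chart_at (chart_inv c y)) \o chart_inv c) y u.

Definition differential (k : M -> R) (x : M) (v : tangent x) : R :=
  'd (k \o chart_inv (chart_at x)) (chart_map (chart_at x) x) v.

Definition tensor2 := forall x : M, tangent x -> tangent x -> R.

Definition bilinear2 (b : tensor2) : Prop :=
  forall x, (forall u, scalar (b x u)) /\ (forall v, scalar (fun u => b x u v)).

Definition alternating2 (b : tensor2) : Prop :=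
  forall (x : M) (u : tangent x), b x u u = 0.

Definition nondegenerate2 (b : tensor2) : Prop :=
  forall (x : M) (u : tangent x), (forall v, b x u v = 0) -> u = 0.

Definition symmetric2 (b : tensor2) : Prop :=
  forall (x : M) (u v : tangent x), b x u v = b x v u.

Definition positive2 (b : tensor2) : Prop :=
  forall (x : M) (u : tangent x), u != 0 -> 0 < b x u u.

(* The component of [b] along the constant vector fields [u], [v] of [c]. *)
Definition component (b : tensor2) (c : chart R d M) (u v y : 'rV[R]_d) : R :=
  b (chart_inv c y) (push c y u) (push c y v).

Definition smooth_tensor2 (b : tensor2) : Prop :=
  forall c, atlas c -> forall u v, smooth_on (cod c) (component b c u v).

(* [dw = 0], expressed in charts: for constant vector fields [u1], [u2], [u3],
   [dw(u1, u2, u3)] is the cyclic sum of the [u1 (w(u2, u3))]. *)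
Definition closed_form (w : tensor2) : Prop :=
  forall c, atlas c -> forall (u1 u2 u3 y : 'rV[R]_d), cod c y ->
    'D_u1 (component w c u2 u3) y + 'D_u2 (component w c u3 u1) y
      + 'D_u3 (component w c u1 u2) y = 0.

Record symplectic_form := SymplecticForm {
  sympl :> forall x : M, tangent x -> tangent x -> R;
  sympl_bilinear : bilinear2 sympl;
  sympl_alternating : alternating2 sympl;
  sympl_smooth : smooth_tensor2 sympl;
  sympl_closed : closed_form sympl;
  sympl_nondegenerate : nondegenerate2 sympl
}.

(* The value at [x] of [X_k], i.e. the unique [v] with [w(v, .) = dk_x]; it
   exists by nondegeneracy, so that the default [0] is never used. *)
Definition hamiltonian_field (w : symplectic_form) (k : M -> R) (x : M) :
    tangent x :=
  xget 0 [set v | forall u, w x v u = differential k u].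

Definition poisson (w : symplectic_form) (f g : M -> R) : M -> R :=
  fun x => differential f (hamiltonian_field w g x).

Record riemannian_metric := RiemannianMetric {
  metric :> forall x : M, tangent x -> tangent x -> R;
  metric_bilinear : bilinear2 metric;
  metric_symmetric : symmetric2 metric;
  metric_positive : positive2 metric;
  metric_smooth : smooth_tensor2 metric
}.

(* Suprema of sets of nonnegative quantities are taken in [0, +oo]; adding
   [0] only makes the supremum of the empty set [0] instead of [-oo]. *)
Definition sup_ge0 (A : set (\bar R)) : \bar R := ereal_sup (0%E |` A).

Definition norm0 (U : set M) (k : M -> R) : \bar R :=
  sup_ge0 [set `|k x|%:E | x in U].

Definition norm1_at (rho : riemannian_metric) (x : M) (k : M -> R) : \bar R :=
  sup_ge0 [set `|differential k v|%:E
          | v in [set v : tangent x | Num.sqrt (rho x v v) = 1]].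

Definition norm1 (rho : riemannian_metric) (U : set M) (k : M -> R) : \bar R :=
  sup_ge0 [set norm1_at rho x k | x in U].

Definition vanishing_rate (rho : riemannian_metric)
    (f g : M -> R) (f_ g_ : nat -> M -> R) : Prop :=
  forall U : set M, open U -> compact (closure U) ->
    (Order.max (norm0 U (f_ n \- f)%R) (norm0 U (g_ n \- g)%R)
       * norm1 rho U (g_ n))%E @[n --> \oo] --> 0%E.

End Manifold.

(* Main.v *)
Require Import Defs.
From mathcomp Require Import all_boot all_order all_algebra.
From mathcomp Require Import all_classical all_reals all_analysis.
From mathcomp Require Import ring lra.
Import Order.TTheory GRing.Theory Num.Theory.
Import numFieldNormedType.Exports.
Set Implicit Arguments.
Unset Strict Implicit.
Unset Printing Implicit Defensive.
Local Open Scope classical_set_scope.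
Local Open Scope ring_scope.

(** Why the theorem is true.  In a chart, let [W] be the matrix of the symplectic
    form and [B = (adj W)^T], which is antisymmetric since [W] is.  Multiplying
    by [det W], which vanishes nowhere, turns the Poisson bracket into
    [bracket B F G = sum_ij B_ij d_iF d_jG] ([poisson_in_chart]).

    With [u = F_n - F] and [v = G_n - G], the difference of the brackets of
    [(F_n, G_n)] and [(F, G)] is a divergence up to terms of order zero in [u]
    and [v] ([bracket_sub_divergence]):
      [bracket B F_n G_n - bracket B F G = div A_n - e_n], where
      [A_n = u (B dG_n) + v (B^T dF)],
      [e_n = u (sum_ij d_iB_ij d_jG_n) + v div (B^T dF)].
    The second derivatives of [G_n] do not occur, because an antisymmetric
    tensor contracted with a Hessian is zero.  So [A_n] and [e_n] are bounded by
    multiples of [|u| |dG_n|] and [|v|]: the first tends to [0] by the hypothesis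
    on the rates, the second by uniform convergence.

    If the limit [h] of the brackets differed from [{f, g}] at a point, then,
    up to sign, [div A_n] would be bounded below by a positive constant on a
    fixed cube while [A_n] tends uniformly to [0].  This contradicts the
    divergence theorem on the cube.  Only the resulting inequality is needed
    ([divergence_bound]); it is obtained from Riemann sums, since the sum over
    a grid of the difference quotients of [A_n] telescopes to boundary terms.

    The condition on the rates is independent of the metric because, on a
    compact set, each of two metrics is bounded by a multiple of the other
    ([metric_comparison]), so that their norms of differentials are
    equivalent there. *)

(** * Symmetry of second derivatives *)

Lemma is_derive_line (R : realType) (V W : normedModType R) (f : V -> W)
    (y v : V) (t : R) :
  derivable f (y + t *: v) v ->
  is_derive t 1 (fun s => f (y + s *: v)) ('D_v f (y + t *: v)).
Proof.
move=> df.
have E : (fun h : R => h^-1 *: (((fun s => f (y + s *: v)) \o shift t) (h *: 1)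
      - f (y + t *: v))) =
    (fun h => h^-1 *: ((f \o shift (y + t *: v)) (h *: v) - f (y + t *: v))).
  apply/funext => h /=; congr (_ *: (f _ - _)).
  by rewrite /shift /= [h *: 1]mulr1 scalerDl addrCA.
by split; rewrite /derivable /derive E.
Qed.

Lemma MVT_line (R : realType) (V : normedModType R) (f : V -> R) (y v : V)
    (h : R) : 0 < h ->
  (forall t, 0 <= t <= h -> derivable f (y + t *: v) v) ->
  exists2 t, 0 <= t <= h & f (y + h *: v) - f y = h * 'D_v f (y + t *: v).
Proof.
move=> h0 df.
have D t : 0 <= t <= h ->
    is_derive t 1 (fun s => f (y + s *: v)) ('D_v f (y + t *: v)).
  by move=> th; apply: is_derive_line; exact: df.
have [| |t] := @MVT R (fun s => f (y + s *: v)) (fun t => 'D_v f (y + t *: v))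
    0 h h0.
- by move=> t; rewrite in_itv /= => /andP[t0 th]; apply: D; rewrite !ltW.
- apply: derivable_within_continuous => t; rewrite in_itv /= => /D dt.
  exact: ex_derive.
rewrite in_itv /= scale0r addr0 subr0 mulrC => /andP[t0 th] E.
by exists t => //; rewrite !ltW.
Qed.

(** The mean value theorem applied first along [u] to the increment of [f] along
    [v], then along [v] to ['D_u f]. *)
Lemma second_difference (R : realType) (V : normedModType R) (A : set V)
    (f F : V -> R) (u v y : V) (h : R) :
  0 < h -> Cn_on 2 A f -> (forall z, 'D_v ('D_u f) z = F z) ->
  (forall s t : R, 0 <= s <= h -> 0 <= t <= h -> A (y + s *: u + t *: v)) ->
  exists s t : R, [/\ 0 <= s <= h, 0 <= t <= h &
    f (y + h *: u + h *: v) - f (y + h *: u) - (f (y + h *: v) - f y)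
    = h * (h * F (y + s *: u + t *: v))].
Proof.
move=> h0 [df d2f] HF HA.
have hh : 0 <= h <= h by rewrite lexx ltW.
have h00 : 0 <= (0 : R) <= h by rewrite lexx ltW.
have HA0 (s : R) : 0 <= s <= h -> A (y + s *: u).
  by move=> sh; have := HA s 0 sh h00; rewrite scale0r addr0.
have D (s : R) : 0 <= s <= h -> is_derive (y + s *: u) u (fun z => f (z + h *: v))
    ('D_u f (y + s *: u + h *: v)).
  move=> sh; have c := @diff_derivable _ _ _ _ _ u (df _ (HA s h sh hh)).
  have E : (fun t : R => t^-1 *: (((fun z => f (z + h *: v)) \o
      shift (y + s *: u)) (t *: u) - f (y + s *: u + h *: v))) =
    (fun t => t^-1 *: ((f \o shift (y + s *: u + h *: v)) (t *: u) -
      f (y + s *: u + h *: v))).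
    by apply/funext => t /=; rewrite /shift /= !addrA.
  by split; rewrite /derivable /derive E.
have D' (s : R) : 0 <= s <= h -> derivable f (y + s *: u) u.
  by move=> sh; exact/diff_derivable/df/HA0.
have [|s sh Es] := @MVT_line R V (fun z => f (z + h *: v) - f z) y u h h0.
  move=> s sh; apply: derivableB; last exact: D'.
  by have := D s sh; case.
have [|t th Et] := @MVT_line R V ('D_u f) (y + s *: u) v h h0.
  by move=> t th; apply: diff_derivable; case: (d2f u) => + _; apply; exact: HA.
exists s, t; split => //; rewrite -HF -Et.
rewrite Es deriveB; [|by have := D s sh; case|exact: D'].
by have := D s sh; case => _ ->.
Qed.

(** The second difference of [f] along [u] and [v] is symmetric in [u] and [v], so
    that by [second_difference] both mixed derivatives, taken at two points near
    [y], agree; continuity carries the equality to [y]. *)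
Lemma mixed_derivatives_eq (R : realType) (V : normedModType R) (A : set V)
    (f F G : V -> R) (u v y : V) :
  open A -> A y -> Cn_on 2 A f ->
  (forall z, 'D_v ('D_u f) z = F z) -> (forall z, 'D_u ('D_v f) z = G z) ->
  {for y, continuous F} -> {for y, continuous G} -> F y = G y.
Proof.
move=> oA Ay Cf HF HG cF cG.
have eps_eq (a b : R) : (forall e : R, 0 < e -> `|a - b| <= e) -> a = b.
  move=> ab; apply/eqP; rewrite -subr_eq0 -normr_le0; apply/ler_addgt0Pl.
  by move=> e e0; rewrite addr0 ab.
apply: eps_eq => e e0.
have e20 : 0 < e / 2 by rewrite divr_gt0.
have near_A : \forall z \near y, A z by exact: open_nbhs_nbhs.
have [r r0 Hr'] : exists2 r : R, 0 < r & forall z, ball y r z ->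
    [/\ A z, `|F y - F z| < e / 2 & `|G y - G z| < e / 2].
  move: cF cG => /(cvgr_dist_lt _ _)/(_ _ e20) cF.
  move=> /(cvgr_dist_lt _ _)/(_ _ e20) cG.
  have /nbhs_ballP[r /= r0 Hr] : nbhs y [set z | [/\ A z,
      `|F y - F z| < e / 2 & `|G y - G z| < e / 2]].
    by near=> z; rewrite /=; split; near: z.
  by exists r.
(* small enough for the parallelogram spanned by [h u] and [h v] to stay in
   the ball of radius [r] *)
pose h : R := r / (`|u| + `|v| + 1).
have n0 : 0 < `|u| + `|v| + 1 by rewrite ltr_wpDl// addr_ge0.
have h0 : 0 < h by rewrite divr_gt0.
have Hr (s t : R) : 0 <= s <= h -> 0 <= t <= h ->
    ball y r (y + s *: u + t *: v).
  move=> /andP[s0 sh] /andP[t0 th].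
  rewrite -ball_normE /= -addrA opprD addrA subrr add0r normrN.
  apply: (le_lt_trans (ler_normD _ _)); rewrite !normrZ !ger0_norm//.
  apply: (@le_lt_trans _ _ (h * `|u| + h * `|v|)).
    by rewrite lerD// ler_wpM2r.
  rewrite -mulrDr -[ltRHS](@divfK _ (`|u| + `|v| + 1)) ?gt_eqF//.
  by rewrite ltr_pM2l// ltrDl.
have [|s [t [sh th E]]] := second_difference (u := u) (v := v) (y := y) h0 Cf HF.
  by move=> s t sh th; case: (Hr' _ (Hr s t sh th)).
have [|s' [t' [sh' th' E']]] := second_difference (u := v) (v := u) (y := y)
  h0 Cf HG.
  by move=> a b ah bh; rewrite addrAC; case: (Hr' _ (Hr b a bh ah)).
have FG : F (y + s *: u + t *: v) = G (y + t' *: u + s' *: v).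
  rewrite (addrAC y (t' *: u)).
  apply/(mulfI (lt0r_neq0 h0))/(mulfI (lt0r_neq0 h0)).
  by rewrite -E -E' (addrAC y); ring.
have [_ + _] := Hr' _ (Hr s t sh th).
have [_ _ +] := Hr' _ (Hr _ _ th' sh').
by rewrite FG !ltr_norml ler_norml; lra.
Unshelve. all: by end_near. Qed.

Lemma derive_comm (R : realType) (V : normedModType R) (A : set V)
    (f : V -> R) (u v y : V) :
  open A -> A y -> Cn_on 2 A f -> 'D_v ('D_u f) y = 'D_u ('D_v f) y.
Proof.
move=> oA Ay Cf.
have [_ /(_ v _ Ay) cu] := Cf.2 u; have [_ /(_ u _ Ay) cv] := Cf.2 v.
exact: (mixed_derivatives_eq oA Ay Cf (fun=> erefl) (fun=> erefl) cu cv).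
Qed.

(** * The divergence of a small vector field *)

(** Near each point of [K] the derivative along [v] varies by less than [e], and
    the mean value theorem turns this into the estimate; compactness makes the
    admissible step [h] common to all points. *)
Lemma difference_quotient_ge (R : realType) (V : normedModType R) (K : set V)
    (f : V -> R) (v : V) (e : R) :
  compact K -> 0 < e -> (forall y, K y -> differentiable f y) ->
  (forall y, K y -> {for y, continuous ('D_v f)}) ->
  \forall h \near (0 : R)^'+, forall y, K y ->
    (forall t : R, 0 <= t <= h -> K (y + t *: v)) ->
    h * ('D_v f y - e) <= f (y + h *: v) - f y.
Proof.
move=> cK e0 df cdf.
pose P (h : R) y := (forall t : R, 0 <= t <= h -> K (y + t *: v)) ->
    h * ('D_v f y - e) <= f (y + h *: v) - f y.
have : \forall h \near (0 : R)^'+, K `<=` P h.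
  move/compact_near_coveringP : cK; apply => x Kx.
  have e20 : 0 < e / 2 by rewrite divr_gt0.
  have /(cvgr_dist_lt _ _)/(_ _ e20) := cdf x Kx.
  move=> /nbhs_ballP[r /= r0 Hr].
  have r20 : 0 < r / 2 by rewrite divr_gt0.
  pose h0 := r / 2 / (`|v| + 1).
  have v1 : 0 < `|v| + 1 by rewrite ltr_wpDl.
  have h00 : 0 < h0 by rewrite divr_gt0.
  exists (ball x (r / 2), [set h : R | 0 < h < h0]).
    split; first exact: nbhsx_ballx.
    near=> h; rewrite /=; apply/andP; split; near: h.
      exact: nbhs_right_gt.
    exact: nbhs_right_lt.
  move=> [y h] /= [yx /andP[hp hh0]] HK.
  have close (t : R) : 0 <= t <= h ->
      `|'D_v f x - 'D_v f (y + t *: v)| < e / 2.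
    move=> /andP[t0 th]; apply: Hr.
    rewrite -ball_normE /= opprD addrA.
    apply: (le_lt_trans (ler_normB _ _)); rewrite normrZ ger0_norm// [ltRHS]splitr.
    rewrite ltr_leD//; first by move: yx; rewrite -ball_normE.
    rewrite -[leRHS](@divfK _ (`|v| + 1)) ?gt_eqF//.
    by apply: ler_pM => //; [exact: (le_trans th (ltW hh0))|rewrite lerDl].
  have [t th ->] : exists2 t : R, 0 <= t <= h &
      f (y + h *: v) - f y = h * 'D_v f (y + t *: v).
    by apply: MVT_line => // t th; apply/diff_derivable/df/HK.
  rewrite ler_pM2l//.
  have := close t th; have := close 0; rewrite lexx ltW// scale0r addr0.
  by move=> /(_ isT); rewrite !ltr_norml; lra.
by apply: filterS => h Hh y Ky; exact: Hh.
Unshelve. all: by end_near. Qed.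

Section Grid.
Context (d M : nat).
Local Notation N := M.+1.
Local Notation grid := {ffun 'I_d -> 'I_N}.
Implicit Type k : grid.

(** The neighbour of a point of the grid along coordinate [i], cyclically: being
    a bijection, it makes sums of differences telescope outside the last layer
    of the grid. *)
Definition grid_shift (i : 'I_d) k : grid :=
  [ffun j => if j == i then ordS (k j) else k j].

Lemma grid_shift_inj i : injective (grid_shift i).
Proof.
move=> k k' /ffunP E; apply/ffunP => j; have := E j; rewrite !ffunE.
by case: eqP => // _; exact: ordS_inj.
Qed.

(** The layer [k i = M] contains [N ^ (d - 1)] points; multiplying by [N] avoids
    the predecessor. *)
Lemma sum_last_layer (R : numFieldType) (i : 'I_d) :
  (\sum_(k : grid) (k i == ord_max)%:R) * N%:R = N%:R ^+ d :> R.
Proof.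
pose F (j : 'I_d) (m : 'I_N) : R := if j == i then (m == ord_max)%:R else 1.
rewrite (eq_bigr (fun k : grid => \prod_j F j (k j))); last first.
  move=> k _; rewrite (bigD1 i)//= big1 ?mulr1; last first.
    by move=> j /negPf ji; rewrite /F ji.
  by rewrite /F eqxx.
rewrite -bigA_distr_bigA (bigD1 i)//= (bigD1 ord_max)//= {1}/F !eqxx big1.
  rewrite addr0 mul1r.
  rewrite (eq_bigr (fun=> N%:R)); last first.
    move=> j /negPf ji; rewrite (eq_bigr (fun=> 1)) /F ?ji//.
    by rewrite sumr_const card_ord.
  rewrite mulrC -[d in RHS]card_ord -prodr_const [RHS](bigD1 i)//=.
move=> m /negPf mm; by rewrite /F eqxx mm.
Qed.

Lemma sum_telescope (R : realFieldType) (i : 'I_d) (F G : grid -> R) (c : R) :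
  (forall k, k i != ord_max -> F k = G (grid_shift i k)) ->
  (forall k, `|F k| <= c) -> (forall k, `|G k| <= c) ->
  (\sum_k (F k - G k)) * N%:R <= 2 * c * N%:R ^+ d.
Proof.
move=> FG Fc Gc.
rewrite sumrB [X in _ - X](reindex_inj (@grid_shift_inj i))/= -sumrB.
rewrite -(sum_last_layer _ i) mulrA ler_pM2r ?ltr0n// mulr_sumr.
apply: ler_sum => k _; have [/eqP ki|/FG ->] := boolP (k i == ord_max).
  rewrite mulr1 mulr_natl mulr2n; apply: (le_trans (ler_norm _)).
  by apply: (le_trans (ler_normB _ _)); rewrite lerD.
by rewrite subrr mulr0.
Qed.

End Grid.

Definition cube (R : realType) (d : nat) (a : 'rV[R]_d) (L : R) :
  set 'rV[R]_d := [set y | forall i, a 0 i <= y 0 i <= a 0 i + L].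

Lemma cube_compact (R : realType) (d : nat) (a : 'rV[R]_d) (L : R) :
  compact (cube a L).
Proof.
exact: (@rV_compact R d (fun i => `[a 0 i, a 0 i + L]%classic)
  (fun i => @segment_compact _ _ _)).
Qed.

(** The divergence theorem on a cube of side [L], as an inequality: the flux
    through the [2 d] faces, at most [2 c d L ^ (d - 1)], is at least
    [e L ^ d].  Summing difference quotients with step [h = L / N] over the grid
    of [N ^ d] points replaces the integral; the sums along each coordinate
    telescope ([sum_telescope]), and the error of the quotients is made
    arbitrarily small with [N]. *)
Lemma divergence_bound (R : realType) (d : nat) (a : 'rV[R]_d) (L c e : R)
    (A : 'I_d -> 'rV[R]_d -> R) :
  0 < L ->
  (forall i y, cube a L y -> differentiable (A i) y) ->
  (forall i y, cube a L y -> {for y, continuous ('D_('e_i) (A i))}) ->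
  (forall i y, cube a L y -> `|A i y| <= c) ->
  (forall y, cube a L y -> e <= \sum_i 'D_('e_i) (A i) y) ->
  e * L <= 2 * c * d%:R.
Proof.
move=> L0 dA cA Ac eA; set Q := cube a L.
apply/ler_addgt0Pr => eta eta0.
(* the error allowed in each difference quotient *)
pose b := eta / (d%:R * L + 1).
have dL : 0 < d%:R * L + 1 by rewrite ltr_wpDl// mulr_ge0// ltW.
have b0 : 0 < b by rewrite divr_gt0.
have [r r0 Hr] : exists2 r : R, 0 < r & forall h, 0 < h < r ->
    forall i y, Q y -> (forall t : R, 0 <= t <= h ->
      Q (y + t *: 'e_i)) ->
    h * ('D_('e_i) (A i) y - b) <=
      A i (y + h *: 'e_i) - A i y.
  have H : \forall h \near (0 : R)^'+, forall i, forall y, Q y ->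
      (forall t : R, 0 <= t <= h -> Q (y + t *: 'e_i)) ->
      h * ('D_('e_i) (A i) y - b) <=
      A i (y + h *: 'e_i) - A i y.
    apply: filter_forall => i; apply: difference_quotient_ge => //.
    - exact: cube_compact.
    - exact: dA.
    - exact: cA.
  move: H => [r /= r0 Hr]; exists r => // h /andP[h0 hr].
  by apply: Hr => //=; rewrite sub0r normrN gtr0_norm.
pose M := Num.truncn (L / r).
pose h := L / M.+1%:R.
have N0 : 0 < M.+1%:R :> R by rewrite ltr0n.
have h0 : 0 < h by rewrite divr_gt0.
have hN : h * M.+1%:R = L by rewrite divfK ?gt_eqF.
have hr : h < r.
  rewrite ltr_pdivrMr// mulrC -ltr_pdivrMr//.
  by rewrite truncnS_gt.
pose p (k : {ffun 'I_d -> 'I_M.+1}) : 'rV[R]_d :=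
  \row_i (a 0 i + h * (k i)%:R).
have Qp k i (t : R) : 0 <= t <= h -> Q (p k + t *: 'e_i).
  move=> /andP[t0 th] j; rewrite !mxE eqxx /=.
  have kj : (k j)%:R + 1 <= M.+1%:R :> R by rewrite natr1 ler_nat ltn_ord.
  have H1 : 0 <= h * (k j)%:R by rewrite mulr_ge0// ltW.
  have H2 : h * ((k j)%:R + 1) <= L by rewrite -hN ler_pM2l.
  rewrite mulrDr mulr1 in H2.
  by case: (j == i); rewrite /= ?mulr1 ?mulr0; apply/andP; split; lra.
have Qp0 k : Q (p k).
  move=> j; rewrite mxE.
  have kj : (k j)%:R <= M.+1%:R :> R by rewrite ler_nat ltnW.
  by rewrite lerDl lerD2l -[X in _ && (_ <= X)]hN ler_pM2l// kj mulr_ge0// ltW.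
have Qph k i : Q (p k + h *: 'e_i) by apply: Qp; rewrite lexx ltW.
have S1 i : (\sum_k (A i (p k + h *: 'e_i) - A i (p k))) * M.+1%:R
    <= 2 * c * M.+1%:R ^+ d.
  apply: (@sum_telescope d M R i) => [k ki|k|k].
  - congr (A i _); apply/rowP => j; rewrite !mxE !ffunE eqxx /=.
    have [->|ji] := eqVneq j i; last by rewrite mulr0 addr0.
    rewrite mulr1 -addrA -[X in _ + (_ + X)]mulr1 -mulrDr natr1.
    congr (_ + _ * _%:R); rewrite /= modn_small// ltn_neqAle ltn_ord andbT.
    by move: ki; rewrite -val_eqE /= eqSS.
  - exact/Ac/Qph.
  - exact/Ac/Qp0.
have S2 : M.+1%:R ^+ d * (h * e) <= \sum_i \sum_k
    (A i (p k + h *: 'e_i) - A i (p k) + h * b).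
  rewrite exchange_big /=.
  have -> : M.+1%:R ^+ d * (h * e) =
      \sum_(k : {ffun 'I_d -> 'I_M.+1}) h * e.
    by rewrite sumr_const card_ffun !card_ord -natrX mulr_natl.
  apply: ler_sum => k _.
  apply: (@le_trans _ _ (\sum_i h * 'D_('e_i) (A i) (p k))).
    by rewrite -mulr_sumr ler_pM2l//; exact: eA (Qp0 k).
  apply: ler_sum => i _.
  have := Hr h; rewrite h0 hr => /(_ isT i (p k) (Qp0 k)).
  by move=> /(_ (Qp k i)); rewrite mulrBr lerBlDr.
have S3 : (\sum_i \sum_k
    (A i (p k + h *: 'e_i) - A i (p k) + h * b)) * M.+1%:R <=
    d%:R * (2 * c * M.+1%:R ^+ d + M.+1%:R ^+ d * (L * b)).
  rewrite mulr_suml.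
  have -> : forall z : R, d%:R * z = \sum_(i < d) z.
    by move=> z; rewrite sumr_const card_ord mulr_natl.
  apply: ler_sum => i _; rewrite big_split /= mulrDl lerD//.
  rewrite sumr_const card_ffun !card_ord -[X in X * _]mulr_natl natrX -hN.
  by rewrite le_eqVlt; apply/orP; left; apply/eqP; ring.
have ND : 0 < M.+1%:R ^+ d :> R by rewrite exprn_gt0.
have S4 : M.+1%:R ^+ d * (e * L) <=
    M.+1%:R ^+ d * (d%:R * (2 * c) + d%:R * L * b).
  move: S2; rewrite -(ler_pM2r N0) => /le_trans/(_ S3) S.
  rewrite -hN; apply: le_trans (le_trans _ S) _; rewrite -?hN;
    by rewrite le_eqVlt; apply/orP; left; apply/eqP; ring.
move: S4; rewrite ler_pM2l// => /le_trans; apply.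
rewrite mulrC lerD2l /b mulrA ler_pdivrMr// mulrC ler_pM2l//.
by rewrite lerDl.
Qed.

(** * Functions of class C1 *)

Lemma continuous_near_eq (T U : topologicalType) (x : T) (f g : T -> U) :
  (\forall z \near x, f z = g z) ->
  {for x, continuous g} -> {for x, continuous f}.
Proof.
move=> fg cg; rewrite /prop_for /continuous_at (nbhs_singleton fg).
by apply: cvg_trans cg; apply: near_eq_cvg; near do apply/esym.
Unshelve. all: by end_near. Qed.

Section C1.
Context (R : realType) (V : normedModType R) (O : set V).
Hypothesis openO : open O.
Implicit Types f g : V -> R.

Lemma C1_cst (c : R) : Cn_on 1 O (fun=> c).
Proof.
split=> [y _|v y _]; first exact: differentiable_cst.
apply: (@continuous_near_eq _ _ _ _ (fun=> 0)); last exact: cst_continuous.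
by near=> z; exact: derive_cst.
Unshelve. all: by end_near. Qed.

Lemma C1D f g : Cn_on 1 O f -> Cn_on 1 O g -> Cn_on 1 O (fun y => f y + g y).
Proof.
move=> [df cf] [dg cg]; split=> [y Oy|v y Oy].
  by apply: differentiableD; [exact: df|exact: dg].
apply: (@continuous_near_eq _ _ _ _ (fun z => 'D_v f z + 'D_v g z)); last first.
  by apply: continuousD; [exact: cf|exact: cg].
have := open_nbhs_nbhs (conj openO Oy); apply: filterS => z Oz.
by apply: deriveD; apply: diff_derivable; [exact: df|exact: dg].
Qed.

Lemma C1M f g : Cn_on 1 O f -> Cn_on 1 O g -> Cn_on 1 O (fun y => f y * g y).
Proof.
move=> [df cf] [dg cg]; split=> [y Oy|v y Oy].
  by apply: differentiableM; [exact: df|exact: dg].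
apply: (@continuous_near_eq _ _ _ _ (fun z => f z * 'D_v g z + g z * 'D_v f z)).
  have := open_nbhs_nbhs (conj openO Oy); apply: filterS => z Oz.
  by apply: deriveM; apply: diff_derivable; [exact: df|exact: dg].
apply: continuousD; apply: continuousM.
- exact/differentiable_continuous/df.
- exact: cg.
- exact/differentiable_continuous/dg.
- exact: cf.
Qed.

Lemma C1N f : Cn_on 1 O f -> Cn_on 1 O (fun y => - f y).
Proof.
move=> Cf; have := C1M (C1_cst (- 1)) Cf; congr Cn_on.
by apply/funext => y; rewrite mulN1r.
Qed.

Lemma C1_sum (I : Type) (r : seq I) (P : pred I) (F : I -> V -> R) :
  (forall i, Cn_on 1 O (F i)) -> Cn_on 1 O (fun y => \sum_(i <- r | P i) F i y).
Proof.
move=> CF; elim: r => [|i r IH].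
  by under eq_fun do rewrite big_nil; exact: C1_cst.
under eq_fun do rewrite big_cons.
by case: (P i); [exact: (C1D (CF i) IH)|exact: IH].
Qed.

Lemma C1_prod (I : Type) (r : seq I) (P : pred I) (F : I -> V -> R) :
  (forall i, Cn_on 1 O (F i)) ->
  Cn_on 1 O (fun y => \prod_(i <- r | P i) F i y).
Proof.
move=> CF; elim: r => [|i r IH].
  by under eq_fun do rewrite big_nil; exact: C1_cst.
under eq_fun do rewrite big_cons.
by case: (P i); [exact: (C1M (CF i) IH)|exact: IH].
Qed.

Lemma C1_det (n : nat) (W : V -> 'M[R]_n) :
  (forall i j, Cn_on 1 O (fun y => W y i j)) -> Cn_on 1 O (fun y => \det (W y)).
Proof.
move=> CW; rewrite /determinant; apply: C1_sum => s.
by apply: C1M; [exact: C1_cst|exact: C1_prod].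
Qed.

Lemma C1_adj (n : nat) (W : V -> 'M[R]_n) i j :
  (forall i j, Cn_on 1 O (fun y => W y i j)) ->
  Cn_on 1 O (fun y => (\adj (W y)) i j).
Proof.
move=> CW; under eq_fun do rewrite mxE /cofactor.
apply: C1M; first exact: C1_cst.
apply: C1_det => k l; under eq_fun do rewrite !mxE; exact: CW.
Qed.

Lemma C1_continuous f y : Cn_on 1 O f -> O y -> {for y, continuous f}.
Proof. by move=> [df _] Oy; exact/differentiable_continuous/df. Qed.

Lemma deriveM_C1 f g v y : Cn_on 1 O f -> Cn_on 1 O g -> O y ->
  'D_v (fun z => f z * g z) y = f y * 'D_v g y + g y * 'D_v f y.
Proof.
by move=> [df _] [dg _] Oy; apply: deriveM; apply: diff_derivable;
  [exact: df|exact: dg].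
Qed.

Lemma deriveD_C1 f g v y : Cn_on 1 O f -> Cn_on 1 O g -> O y ->
  'D_v (fun z => f z + g z) y = 'D_v f y + 'D_v g y.
Proof.
by move=> [df _] [dg _] Oy; apply: deriveD; apply: diff_derivable;
  [exact: df|exact: dg].
Qed.

Lemma derive_sum_C1 n (F : 'I_n -> V -> R) v y :
  (forall i, Cn_on 1 O (F i)) -> O y ->
  'D_v (fun z => \sum_i F i z) y = \sum_i 'D_v (F i) y.
Proof.
move=> CF Oy; rewrite -derive_sum; last first.
  by move=> i; apply: diff_derivable; have [+ _] := CF i; exact.
by congr derive; apply/funext => z; rewrite fct_sumE.
Qed.

End C1.

Lemma bounded_on_compact (R : realType) (T : topologicalType) (I : finType)
    (K : set T) (F : I -> T -> R) :
  compact K -> (forall i y, K y -> {for y, continuous (F i)}) ->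
  exists2 C : R, 0 < C & forall i y, K y -> `|F i y| <= C.
Proof.
move=> cK cF.
suff H : \forall C \near +oo, K `<=` (fun y => forall i, `|F i y| <= C).
  have [C [_ HC]] := H; exists (`|C| + 1) => [|i y Ky].
    by rewrite ltr_wpDl.
  by apply: HC => //; rewrite (le_lt_trans (ler_norm C))// ltrDl.
move/compact_near_coveringP : cK; apply => x Kx.
have H i : \forall y \near x & C \near +oo, `|F i y| <= C.
  exists ([set y | `|F i x - F i y| < 1], [set C | `|F i x| + 1 <= C]).
    split; last by apply: nbhs_pinfty_ge; rewrite num_real.
    exact: (cvgr_dist_lt _ _ (cF i x Kx)).
  move=> [y C] /= [H1 H2]; apply: le_trans H2.
  rewrite -lerBlDl; apply: le_trans (ltW H1).
  by rewrite distrC; exact: lerB_dist.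
apply: (filter_forall _ H).
Qed.

Lemma sum_antisym_sym (R : realFieldType) (d : nat) (B H : 'I_d -> 'I_d -> R) :
  (forall i j, B i j = - B j i) -> (forall i j, H i j = H j i) ->
  \sum_i \sum_j B i j * H i j = 0.
Proof.
move=> aB sH; set S := LHS.
have : S = - S.
  rewrite {1}/S exchange_big -sumrN /=; apply: eq_bigr => i _.
  by rewrite -sumrN; apply: eq_bigr => j _; rewrite aB sH mulNr.
lra.
Qed.

(** * Limits of antisymmetric brackets in R^d *)

Lemma Cn_onS (R : realType) (V W : normedModType R) (n : nat) (A : set V)
    (f : V -> W) : Cn_on n.+1 A f -> Cn_on n A f.
Proof.
elim: n f => [|n IH] f [df Cf].
  by move=> y Ay; exact/differentiable_continuous/df.
by split=> // v; exact: IH.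
Qed.

Lemma Cn_on_sub (R : realType) (V W : normedModType R) (n : nat) (A A' : set V)
    (f : V -> W) : A' `<=` A -> Cn_on n A f -> Cn_on n A' f.
Proof.
move=> sA; elim: n f => [|n IH] f; first by move=> Cf y /sA; exact: Cf.
by move=> [df Cf]; split=> [y /sA|v]; [exact: df|exact: IH (Cf v)].
Qed.

Lemma nbhs_cube (R : realType) (d : nat) (y0 : 'rV[R]_d) (P : set 'rV[R]_d) :
  nbhs y0 P -> exists2 L : R, 0 < L & cube y0 L `<=` P.
Proof.
move=> /nbhs_ballP[r /= r0 Hr]; exists (r / 2); first by rewrite divr_gt0.
move=> y yQ; apply: Hr; split => // i j; rewrite ord1.
have := yQ j; rewrite -ball_normE /= => /andP[y1 y2].
rewrite distrC ger0_norm ?subr_ge0//; lra.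
Qed.

Section LocalBracket.
Context (R : realType) (d : nat).
Local Notation E := 'rV[R]_d.

(** The bracket of the bivector field [B]; a Poisson bracket has this form in
    coordinates. *)
Definition bracket (B : 'I_d -> 'I_d -> E -> R) (F G : E -> R) (y : E) : R :=
  \sum_i \sum_j B i j y * ('D_('e_i) F y * 'D_('e_j) G y).

(** By the Leibniz rule: the terms where [F' - F] and [G' - G] are differentiated
    give the difference of the brackets, by bilinearity.  The remaining terms
    with second derivatives of [G'] cancel, [B] being antisymmetric and the
    Hessian symmetric. *)
Lemma bracket_sub_divergence (O : set E) (B : 'I_d -> 'I_d -> E -> R)
    (F G F' G' : E -> R) (y : E) :
  open O -> O y -> (forall i j, Cn_on 1 O (B i j)) ->
  (forall i j y, O y -> B i j y = - B j i y) ->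
  Cn_on 2 O F -> Cn_on 1 O G -> Cn_on 1 O F' -> Cn_on 2 O G' ->
  \sum_i 'D_('e_i) (fun z =>
      (F' z - F z) * (\sum_j B i j z * 'D_('e_j) G' z)
    + (G' z - G z) * (\sum_j B j i z * 'D_('e_j) F z)) y
  = bracket B F' G' y - bracket B F G y
  + (F' y - F y) * (\sum_i \sum_j
       'D_('e_i) (B i j) y * 'D_('e_j) G' y)
  + (G' y - G y) * (\sum_i 'D_('e_i)
       (fun z => \sum_j B j i z * 'D_('e_j) F z) y).
Proof.
move=> oO Oy CB aB CF CG CF' CG'.
have CF1 := Cn_onS CF; have CG'1 := Cn_onS CG'.
have CdF j : Cn_on 1 O ('D_('e_j) F) := CF.2 _.
have CdG' j : Cn_on 1 O ('D_('e_j) G') := CG'.2 _.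
have Cu : Cn_on 1 O (fun z => F' z - F z) by exact: (C1D oO CF' (C1N oO CF1)).
have Cv : Cn_on 1 O (fun z => G' z - G z) by exact: (C1D oO CG'1 (C1N oO CG)).
have Du v : 'D_v (fun z => F' z - F z) y = 'D_v F' y - 'D_v F y.
  by apply: deriveB; apply: diff_derivable; [case: CF'|case: CF1] => + _; exact.
have Dv v : 'D_v (fun z => G' z - G z) y = 'D_v G' y - 'D_v G y.
  by apply: deriveB; apply: diff_derivable; [case: CG'1|case: CG] => + _; exact.
have CP i : Cn_on 1 O (fun z => \sum_j B i j z * 'D_('e_j) G' z).
  exact: (C1_sum oO _ _ (fun j => C1M oO (CB i j) (CdG' j))).
have CQ i : Cn_on 1 O (fun z => \sum_j B j i z * 'D_('e_j) F z).
  exact: (C1_sum oO _ _ (fun j => C1M oO (CB j i) (CdF j))).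
have DP : \sum_i 'D_('e_i) (fun z =>
      \sum_j B i j z * 'D_('e_j) G' z) y =
    \sum_i \sum_j 'D_('e_i) (B i j) y * 'D_('e_j) G' y.
  transitivity (\sum_i \sum_j (B i j y *
      'D_('e_i) ('D_('e_j) G') y +
      'D_('e_i) (B i j) y * 'D_('e_j) G' y)).
    apply: eq_bigr => i _.
    rewrite (derive_sum_C1 _ (fun j => C1M oO (CB i j) (CdG' j)) Oy).
    apply: eq_bigr => j _; rewrite (deriveM_C1 _ (CB i j) (CdG' j) Oy).
    by rewrite [X in _ + X]mulrC.
  under eq_bigr do rewrite big_split; rewrite big_split /=.
  have -> : \sum_i \sum_j B i j y *
      'D_('e_i) ('D_('e_j) G') y = 0.
    apply: (sum_antisym_sym (B := fun i j => B i j y)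
      (H := fun i j => 'D_('e_i) ('D_('e_j) G') y)).
    - by move=> i j; exact: aB.
    - by move=> i j; exact: (derive_comm _ _ oO).
  by rewrite add0r.
transitivity (\sum_i (
    ((F' y - F y) * 'D_('e_i) (fun z =>
       \sum_j B i j z * 'D_('e_j) G' z) y
    + (\sum_j B i j y * 'D_('e_j) G' y) *
       ('D_('e_i) F' y - 'D_('e_i) F y))
  + ((G' y - G y) * 'D_('e_i) (fun z =>
       \sum_j B j i z * 'D_('e_j) F z) y
    + (\sum_j B j i y * 'D_('e_j) F y) *
       ('D_('e_i) G' y - 'D_('e_i) G y)))).
  apply: eq_bigr => i _.
  rewrite (deriveD_C1 _ (C1M oO Cu (CP i)) (C1M oO Cv (CQ i)) Oy).
  by rewrite (deriveM_C1 _ Cu (CP i) Oy) (deriveM_C1 _ Cv (CQ i) Oy) Du Dv.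
have split_sum (a b : R) (p p' q q' : 'I_d -> R) :
    \sum_i ((a * p i + q i) + (b * p' i + q' i)) =
    a * (\sum_i p i) + \sum_i q i + (b * (\sum_i p' i) + \sum_i q' i).
  by rewrite !big_split /= -!mulr_sumr.
have collect (a b S S' T P Q D : R) : S = S' -> D = P + Q ->
    a * S + P + (b * T + Q) = D + a * S' + b * T by move=> -> ->; ring.
apply: (etrans (split_sum _ _ _ _ _ _)); apply: (collect _ _ _ _ _ _ _ _ DP).
have -> : bracket B F' G' y - bracket B F G y =
  (bracket B F' G' y - bracket B F G' y) + (bracket B F G' y - bracket B F G y).
  by ring.
congr (_ + _).
  rewrite -sumrB; apply: eq_bigr => i _; rewrite -sumrB mulr_suml.
  by apply: eq_bigr => j _; ring.
rewrite -sumrB; under eq_bigr do rewrite -sumrB; rewrite exchange_big /=.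
apply: eq_bigr => i _; rewrite mulr_suml.
by apply: eq_bigr => j _; ring.
Qed.

(** If [w y0 > 0], then [w > w y0 / 2] on a cube.  There the field [A] of
    [bracket_sub_divergence] has size at most [e * k2], and divergence at least
    [w y0 / 2 - e * k1], for constants [k1] and [k2] that do not depend on [n].
    For small [e] this contradicts [divergence_bound]. *)
Lemma bracket_limit_le0 (O : set E) (B : 'I_d -> 'I_d -> E -> R)
    (F G w : E -> R) (F_ G_ : nat -> E -> R) (y0 : E) :
  open O -> O y0 -> (forall i j, Cn_on 1 O (B i j)) ->
  (forall i j y, O y -> B i j y = - B j i y) ->
  Cn_on 2 O F -> Cn_on 1 O G ->
  (forall n, Cn_on 1 O (F_ n)) -> (forall n, Cn_on 2 O (G_ n)) ->
  {for y0, continuous w} ->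
  (forall e : R, 0 < e -> \forall n \near \oo, forall y j, O y ->
     `|F_ n y - F y| * `|'D_('e_j) (G_ n) y| <= e) ->
  (forall e : R, 0 < e -> \forall n \near \oo, forall y, O y ->
     `|G_ n y - G y| <= e) ->
  (forall e : R, 0 < e -> \forall n \near \oo, forall y, O y ->
     `|bracket B (F_ n) (G_ n) y - bracket B F G y - w y| <= e) ->
  w y0 <= 0.
Proof.
move=> oO Oy0 CB aB CF CG CF_ CG_ cw hFG hG hw.
rewrite leNgt; apply/negP => w0.
pose ep := w y0 / 2; have ep0 : 0 < ep by rewrite divr_gt0.
have [L L0 QO] : exists2 L : R, 0 < L &
    cube y0 L `<=` [set y | O y /\ ep < w y].
  apply: nbhs_cube; apply: filterI; first exact: open_nbhs_nbhs.
  have /(cvgr_dist_lt _ _)/(_ _ ep0) := cw; apply: filterS => y /=.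
  by rewrite ltr_norml /ep; lra.
set Q := cube y0 L in QO.
have cQ : compact Q by exact: cube_compact.
have CF1 := Cn_onS CF.
have CdF j : Cn_on 1 O ('D_('e_j) F) := CF.2 _.
pose S i z := \sum_j B j i z * 'D_('e_j) F z.
have CS i : Cn_on 1 O (S i).
  by exact: (C1_sum oO _ _ (fun j => C1M oO (CB j i) (CdF j))).
have [K1 K10 HK1] := @bounded_on_compact R _ ('I_d * 'I_d)%type Q
  (fun p => B p.1 p.2) cQ
  (fun p y Qy => C1_continuous (CB p.1 p.2) (QO y Qy).1).
have [K2 K20 HK2] := @bounded_on_compact R _ ('I_d * 'I_d)%type Q
  (fun p => 'D_('e_p.1) (B p.1 p.2)) cQ
  (fun p y Qy => (CB p.1 p.2).2 _ y (QO y Qy).1).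
have [K3 K30 HK3] := @bounded_on_compact R _ 'I_d Q S cQ
  (fun i y Qy => C1_continuous (CS i) (QO y Qy).1).
have [K4 K40 HK4] := @bounded_on_compact R _ 'I_d Q
  (fun i => 'D_('e_i) (S i)) cQ
  (fun i y Qy => (CS i).2 _ y (QO y Qy).1).
pose k1 := 1 + (d%:R * (d%:R * K2) + d%:R * K4).
pose k2 := d%:R * K1 + K3.
have k10 : 0 < k1 by rewrite ltr_wpDr// addr_ge0// !mulr_ge0// ltW.
have k20 : 0 < k2 by rewrite ltr_wpDl// mulr_ge0// ltW.
have k3 : 0 < k1 * L + 2 * k2 * d%:R.
  by rewrite ltr_wpDr ?mulr_gt0// !mulr_ge0// ltW.
(* makes the bound of [divergence_bound] fail by a factor [2] *)
pose e := ep * L / 2 / (k1 * L + 2 * k2 * d%:R).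
have e0 : 0 < e by rewrite !divr_gt0// mulr_gt0.
have [n [H1 H2 H3]] : exists n, [/\ forall y j, O y ->
       `|F_ n y - F y| * `|'D_('e_j) (G_ n) y| <= e,
     forall y, O y -> `|G_ n y - G y| <= e &
     forall y, O y ->
       `|bracket B (F_ n) (G_ n) y - bracket B F G y - w y| <= e].
  near (\oo : set_system nat) => n; exists n; split; near: n.
  - exact: hFG.
  - exact: hG.
  - exact: hw.
pose A i z := (F_ n z - F z) * (\sum_j B i j z * 'D_('e_j) (G_ n) z)
    + (G_ n z - G z) * S i z.
have sumd (I : finType) (f : I -> R) (c : R) :
    (forall i, `|f i| <= c) -> `|\sum_i f i| <= #|I|%:R * c.
  move=> fc; apply: (le_trans (ler_norm_sum _ _ _)).
  apply: (@le_trans _ _ (\sum_(i : I) c)); first exact: ler_sum.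
  by rewrite sumr_const mulr_natl.
have uB y (b : R) K j : O y -> 0 < K -> `|b| <= K ->
    `|(F_ n y - F y) * (b * 'D_('e_j) (G_ n) y)| <= K * e.
  move=> Oy K0 bK; rewrite mulrCA normrM; apply: ler_pM => //.
  by rewrite normrM; exact: H1.
have CA i : Cn_on 1 O (A i).
  have Cu := C1D oO (CF_ n) (C1N oO CF1).
  have Cv := C1D oO (Cn_onS (CG_ n)) (C1N oO CG).
  have CP := C1_sum oO (index_enum _) xpredT
    (fun j => C1M oO (CB i j) ((CG_ n).2 'e_j)).
  by exact: (C1D oO (C1M oO Cu CP) (C1M oO Cv (CS i))).
have Abound i y : Q y -> `|A i y| <= e * k2.
  move=> Qy; have [Oy _] := QO y Qy; apply: (le_trans (ler_normD _ _)).
  rewrite /k2 mulrDr; apply: lerD.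
    rewrite mulr_sumr -[d in d%:R]card_ord [leRHS]mulrCA [e * _]mulrC.
    by apply: (sumd _ _ _) => j; apply: uB => //; exact: (HK1 (i, j)).
  by rewrite normrM; apply: ler_pM => //; [exact: H2|exact: HK3].
have divA y : Q y -> ep - e * k1 <= \sum_i 'D_('e_i) (A i) y.
  move=> Qy; have [Oy wy] := QO y Qy.
  rewrite (bracket_sub_divergence oO Oy CB aB CF CG (CF_ n) (CG_ n)).
  have T1 : `|(F_ n y - F y) * (\sum_i \sum_j
       'D_('e_i) (B i j) y * 'D_('e_j) (G_ n) y)| <=
      d%:R * (d%:R * (K2 * e)).
    rewrite mulr_sumr -[X in X%:R * (_ * _)]card_ord; apply: (sumd _ _ _) => i.
    rewrite mulr_sumr -[X in X%:R * _]card_ord; apply: (sumd _ _ _) => j.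
    by apply: uB => //; exact: (HK2 (i, j)).
  have T2 : `|(G_ n y - G y) * (\sum_i 'D_('e_i)
       (fun z => \sum_j B j i z * 'D_('e_j) F z) y)| <= e * (d%:R * K4).
    rewrite normrM; apply: ler_pM => //; first exact: H2.
    by rewrite -[d in d%:R]card_ord; apply: (sumd _ _ _) => i; exact: HK4.
  have T3 := H3 y Oy.
  suff key (X v a b : R) : `|a| <= d%:R * (d%:R * (K2 * e)) ->
      `|b| <= e * (d%:R * K4) -> `|X - v| <= e -> ep < v ->
      ep - e * k1 <= X + a + b by exact: key T1 T2 T3 wy.
  have : e * k1 = e + (d%:R * (d%:R * (K2 * e))) + e * (d%:R * K4).
    by rewrite /k1; ring.
  by rewrite !ler_norml => + /andP[+ _] /andP[+ _] /andP[+ _]; lra.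
have := divergence_bound L0 (fun i y Qy => (CA i).1 y (QO y Qy).1)
  (fun i y Qy => (CA i).2 _ y (QO y Qy).1) Abound divA.
have : ep * L / 2 = e * (k1 * L + 2 * k2 * d%:R) by rewrite divfK// gt_eqF.
have : 0 < ep * L by rewrite mulr_gt0.
have -> : e * (k1 * L + 2 * k2 * d%:R) = e * k1 * L + 2 * (e * k2) * d%:R.
  by ring.
by rewrite mulrBl; lra.
Unshelve. all: by end_near. Qed.

Lemma bracket_limit (O : set E) (B : 'I_d -> 'I_d -> E -> R)
    (F G w : E -> R) (F_ G_ : nat -> E -> R) (y0 : E) :
  open O -> O y0 -> (forall i j, Cn_on 1 O (B i j)) ->
  (forall i j y, O y -> B i j y = - B j i y) ->
  Cn_on 2 O F -> Cn_on 1 O G ->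
  (forall n, Cn_on 1 O (F_ n)) -> (forall n, Cn_on 2 O (G_ n)) ->
  {for y0, continuous w} ->
  (forall e : R, 0 < e -> \forall n \near \oo, forall y j, O y ->
     `|F_ n y - F y| * `|'D_('e_j) (G_ n) y| <= e) ->
  (forall e : R, 0 < e -> \forall n \near \oo, forall y, O y ->
     `|G_ n y - G y| <= e) ->
  (forall e : R, 0 < e -> \forall n \near \oo, forall y, O y ->
     `|bracket B (F_ n) (G_ n) y - bracket B F G y - w y| <= e) ->
  w y0 = 0.
Proof.
move=> oO Oy0 CB aB CF CG CF_ CG_ cw hFG hG hw.
apply/eqP; rewrite eq_le; apply/andP; split.
  exact: (bracket_limit_le0 oO Oy0 CB aB CF CG CF_ CG_ cw hFG hG hw).
rewrite -oppr_le0.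
have bN F' G' y : bracket (fun i j z => - B i j z) F' G' y = - bracket B F' G' y.
  rewrite /bracket -sumrN; apply: eq_bigr => i _; rewrite -sumrN.
  by apply: eq_bigr => j _; rewrite mulNr.
apply: (bracket_limit_le0 (B := fun i j z => - B i j z) (w := fun y => - w y)
  oO Oy0 _ _ CF CG CF_ CG_ _ hFG hG).
- by move=> i j; exact: (C1N oO (CB i j)).
- by move=> i j y Oy; rewrite aB.
- exact: continuousN.
- move=> e /hw; apply: filterS => n hn y Oy.
  by rewrite !bN -!opprD normrN; exact: hn.
Qed.
End LocalBracket.

(** * Charts and tangent vectors *)

Lemma scalar_sum (R : realType) (U : lmodType R) (n : nat) (f : U -> R)
    (a : 'I_n -> R) (v : 'I_n -> U) :
  scalar f -> f (\sum_i a i *: v i) = \sum_i a i * f (v i).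
Proof.
move=> lf; have f0 : f 0 = 0.
  by have := lf (-1) 0 0; rewrite scaler0 addr0 mulN1r addNr.
elim/big_ind2 : _ => //= [x r y s <- <-|i _].
  by have := lf 1 r s; rewrite scale1r mul1r.
by have := lf (a i) (v i) 0; rewrite !addr0 f0 addr0.
Qed.

Section Charts.
Context (R : realType) (d : nat) (M : manifold R d).
Local Notation E := 'rV[R]_d.
Implicit Types (c : chart R d M) (x : M) (y u v : E) (k : M -> R).

Lemma near_transition c c' y : cod c y -> dom c' (chart_inv c y) ->
  \forall z \near y, cod c z /\ dom c' (chart_inv c z).
Proof.
move=> cy dx; apply: filterI.
  by apply: open_nbhs_nbhs; split => //; exact: cod_open.
have : nbhs (chart_inv c y) (dom c').
  by apply: open_nbhs_nbhs; split => //; exact: dom_open.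
exact: (chart_inv_continuous cy).
Qed.

Lemma transition_differentiable c c' y : atlas c -> atlas c' -> cod c y ->
  dom c' (chart_inv c y) -> differentiable (chart_map c' \o chart_inv c) y.
Proof. by move=> ac ac' cy dx; have [+ _] := atlas_smooth ac ac' 1; apply. Qed.

(** Transition maps are inverse to each other near [y], hence so are their
    differentials. *)
Lemma transition_diffK c c' y u : atlas c -> atlas c' -> cod c y ->
  dom c' (chart_inv c y) ->
  'd (chart_map c \o chart_inv c') (chart_map c' (chart_inv c y))
    ('d (chart_map c' \o chart_inv c) y u) = u.
Proof.
move=> ac ac' cy dx.
have df := transition_differentiable ac ac' cy dx.
have cy' : cod c' (chart_map c' (chart_inv c y)) by exact: chart_map_cod.
have dg : differentiable (chart_map c \o chart_inv c')
    ((chart_map c' \o chart_inv c) y).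
  apply: transition_differentiable => //=; rewrite chart_mapK//.
  exact: chart_inv_dom.
have := diff_comp df dg => /(congr1 (fun h : E -> E => h u)) /= <-.
rewrite -deriveE; last exact: differentiable_comp.
rewrite -[RHS](derive_id y u); apply: near_eq_derive.
have := near_transition cy dx; apply: filterS => z [cz dz] /=.
by rewrite chart_mapK// chart_invK.
Qed.

Lemma smooth_Cn c k n : smooth k -> atlas c -> Cn_on n (cod c) (k \o chart_inv c).
Proof. by move=> sk ac; exact: sk. Qed.

Section Push.
Context (c : chart R d M) (y : E).
Hypotheses (ac : atlas c) (cy : cod c y).
Let c' := chart_at (chart_inv c y).

(** The chain rule: the representation of [dk] in the selected chart agrees with
    the derivative of [k] read in [c]. *)
Lemma differential_push k u : smooth k ->
  differential k (push c y u) = 'D_u (k \o chart_inv c) y.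
Proof.
move=> sk; rewrite /differential /push.
have ac' : atlas c' by exact: chart_at_atlas.
have dx : dom c' (chart_inv c y) by exact: chart_at_dom.
have df := transition_differentiable ac ac' cy dx.
have dg : differentiable (k \o chart_inv c')
    ((chart_map c' \o chart_inv c) y).
  have [+ _] := smooth_Cn 1 sk ac'; apply.
  exact: chart_map_cod.
have := diff_comp df dg => /(congr1 (fun h : E -> R => h u)) /= <-.
rewrite -deriveE; last exact: differentiable_comp.
apply: near_eq_derive.
have := near_transition cy dx; apply: filterS => z [cz dz] /=.
by rewrite chart_mapK.
Qed.

Lemma push_surj (v : tangent (chart_inv c y)) : exists u, push c y u = v.
Proof.
have ac' : atlas c' by exact: chart_at_atlas.
have dx : dom c' (chart_inv c y) by exact: chart_at_dom.
have cy' : cod c' (chart_map c' (chart_inv c y)) by exact: chart_map_cod.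
exists ('d (chart_map c \o chart_inv c') (chart_map c' (chart_inv c y)) v).
have := @transition_diffK c' c _ v ac' ac cy'.
by rewrite chart_mapK// chart_invK//; apply; exact: chart_inv_dom.
Qed.

Lemma push_eq0 u : push c y u = 0 -> u = 0.
Proof.
have ac' : atlas c' by exact: chart_at_atlas.
have dx : dom c' (chart_inv c y) by exact: chart_at_dom.
move=> pu; rewrite -[LHS](transition_diffK u ac ac' cy dx).
set D := 'd (chart_map c \o chart_inv c') _.
exact: etrans (congr1 D pu) (linear0 D).
Qed.

Lemma push_coord u : push c y u = \sum_i u 0 i *: push c y 'e_i.
Proof.
rewrite {1}(row_sum_delta u).
rewrite /push linear_sum; apply: eq_bigr => i _; exact: linearZ.
Qed.

Lemma component_coord b u v : bilinear2 b ->
  component b c u v y = \sum_i \sum_j u 0 i * v 0 j * component b c 'e_i 'e_j y.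
Proof.
move=> lb; rewrite /component (push_coord u).
have [l1 l2] := lb (chart_inv c y).
rewrite (scalar_sum _ _ (l2 (push c y v))); apply: eq_bigr => i _.
rewrite {1}(push_coord v) (scalar_sum _ _ (l1 _)) mulr_sumr.
by apply: eq_bigr => j _; rewrite mulrA.
Qed.

End Push.
End Charts.

(** * The Poisson bracket in a chart *)

Section Symplectic.
Context (R : realType) (d : nat) (M : manifold R d) (w : symplectic_form M).
Context (c : chart R d M).
Hypothesis ac : atlas c.
Local Notation E := 'rV[R]_d.
Implicit Types (y u v : E) (k f g : M -> R).

Definition form_matrix y : 'M[R]_d := \matrix_(i, j) component w c 'e_i 'e_j y.

Lemma form_matrix_smooth i j : Cn_on 1 (cod c) (fun y => form_matrix y i j).
Proof.
have := sympl_smooth w ac 'e_i 'e_j 1; congr Cn_on.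
by apply/funext => y; rewrite mxE.
Qed.

Lemma form_matrix_tr y : (form_matrix y)^T = - form_matrix y.
Proof.
apply/matrixP => i j; rewrite !mxE /component.
set a := push c y _; set b := push c y _.
have [l1 l2] := sympl_bilinear w (chart_inv c y).
have := sympl_alternating w (1 *: a + b).
rewrite (l2 _ 1 a b) /= (l1 a 1 a b) (l1 b 1 a b) !(sympl_alternating w).
rewrite !mul1r !add0r addr0.
by move/eqP; rewrite addr_eq0 => /eqP.
Qed.

Section AtPoint.
Variable y : E.
Hypothesis cy : cod c y.

Lemma form_matrixE u v :
  component w c u v y = \sum_j (u *m form_matrix y) 0 j * v 0 j.
Proof.
rewrite (component_coord _ _ _ _ (sympl_bilinear w)) exchange_big /=.
apply: eq_bigr => j _; rewrite mxE mulr_suml.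
by apply: eq_bigr => i _; rewrite mxE mulrAC.
Qed.

Lemma form_matrix_unit : form_matrix y \in unitmx.
Proof.
rewrite unitmxE unitfE; apply/det0P => -[u u0 uW]; case/eqP: u0.
apply: (push_eq0 ac cy); apply: (sympl_nondegenerate (s := w)) => v.
have [t <-] := push_surj ac cy v.
rewrite -[LHS]/(component w c u t y) form_matrixE uW big1// => j _.
by rewrite mxE mul0r.
Qed.

Lemma gradientE k u : smooth k ->
  differential k (push c y u) = \sum_j 'D_('e_j) (k \o chart_inv c) y * u 0 j.
Proof.
move=> sk; rewrite differential_push// deriveE; last first.
  by have [+ _] := smooth_Cn 1 sk ac; apply.
rewrite {1}(row_sum_delta u) linear_sum; apply: eq_bigr => j _.
rewrite linearZ mulrC deriveE//.
by have [+ _] := smooth_Cn 1 sk ac; apply.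
Qed.

(** Nondegeneracy makes the matrix of the form invertible, which provides the
    vector that the definition of [hamiltonian_field] selects. *)
Lemma hamiltonian_fieldP k : smooth k -> forall u : tangent (chart_inv c y),
  w _ (hamiltonian_field w k (chart_inv c y)) u = differential k u.
Proof.
move=> sk; apply: (@xgetPex _ _ [set v | forall u : tangent (chart_inv c y),
  w _ v u = differential k u]).
pose G : E := \row_j 'D_('e_j) (k \o chart_inv c) y.
exists (push c y (G *m invmx (form_matrix y))) => v.
have [t <-] := push_surj ac cy v.
rewrite -[LHS]/(component w c (G *m invmx (form_matrix y)) t y) form_matrixE.
rewrite mulmxKV ?form_matrix_unit// gradientE//.
by apply: eq_bigr => j _; rewrite mxE.
Qed.

Lemma adj_form_matrix_tr : (\adj (form_matrix y))^T = - \adj (form_matrix y).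
Proof.
have u := form_matrix_unit.
have -> : \adj (form_matrix y) = \det (form_matrix y) *: invmx (form_matrix y).
  rewrite /invmx u scalerA divrr ?scale1r//.
rewrite linearZ /= trmx_inv form_matrix_tr -scalerN; congr (_ *: _).
have uN : - form_matrix y \in unitmx by rewrite -form_matrix_tr unitmx_tr.
by rewrite -[LHS]mul1mx -(mulVmx u) -[X in _ *m X *m _]opprK mulmxN mulNmx
  mulmxK.
Qed.

(** The coordinates [z] of the Hamiltonian field of [g] solve [z W = dG]; hence
    [det W * z = dG adj W].  Multiplying by [det W] keeps every coefficient
    polynomial in the entries of [W]. *)
Lemma poisson_in_chart f g : smooth f -> smooth g ->
  \det (form_matrix y) * poisson w f g (chart_inv c y) =
  bracket (fun i j z => \adj (form_matrix z) j i)
    (f \o chart_inv c) (g \o chart_inv c) y.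
Proof.
move=> sf sg; rewrite /poisson.
have [z zE] := push_surj ac cy (hamiltonian_field w g (chart_inv c y)).
have zW : z *m form_matrix y = \row_j 'D_('e_j) (g \o chart_inv c) y.
  apply/rowP => j; rewrite [RHS]mxE.
  have := hamiltonian_fieldP sg (push c y 'e_j).
  rewrite -zE differential_push// => <-.
  rewrite -[RHS]/(component w c z 'e_j y) form_matrixE (bigD1 j)//= big1.
    by rewrite addr0 [X in _ = _ * X]mxE !eqxx mulr1.
  by move=> i /negPf ij; rewrite [X in _ * X]mxE ij andbF mulr0.
rewrite -zE gradientE// mulr_sumr; apply: eq_bigr => i _.
rewrite mulrCA.
have -> : \det (form_matrix y) * z 0 i =
    ((z *m form_matrix y) *m \adj (form_matrix y)) 0 i.
  by rewrite -mulmxA mul_mx_adj mul_mx_scalar mxE.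
rewrite zW mxE mulr_sumr; apply: eq_bigr => j _.
by rewrite mxE mulrCA mulrC mulrCA mulrA.
Qed.
End AtPoint.
End Symplectic.

(** * Norms of differentials and balls of charts *)

Lemma uniform_cvg_le (R : realType) (T : choiceType) (f_ : nat -> T -> R)
    (f : T -> R) (e : R) : {uniform, f_ @ \oo --> f} -> 0 < e ->
  \forall n \near \oo, forall x, `|f_ n x - f x| <= e.
Proof.
move=> cf e0; apply: (cf [set h : {uniform T -> R} | forall x, `|h x - f x| <= e]).
apply/uniform_nbhs; exists [set xy : R * R | ball xy.1 e xy.2]; split.
  exact: (entourage_ball _ (PosNum e0)).
move=> h /= H x; have := H x I; rewrite -ball_normE /= distrC; exact: ltW.
Qed.

Section SupGe0.
Context (R : realType).
Implicit Types (A : set (\bar R)) (a b : \bar R).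

Lemma le_sup_ge0 A a : A a -> (a <= sup_ge0 A)%E.
Proof. by move=> Aa; apply: ereal_sup_ubound; right. Qed.

Lemma sup_ge0_ge0 A : (0 <= sup_ge0 A)%E.
Proof. by apply: ereal_sup_ubound; left. Qed.

Lemma sup_ge0_le A b : (0 <= b)%E -> (forall a, A a -> (a <= b)%E) ->
  (sup_ge0 A <= b)%E.
Proof. by move=> b0 Ab; apply: ge_ereal_sup => a [->//|]; exact: Ab. Qed.
End SupGe0.

Section Norms.
Context (R : realType) (d : nat) (M : manifold R d).
Implicit Types (rho : riemannian_metric M) (U : set M) (k : M -> R).

Lemma metric_scale rho (x : M) (v : tangent x) (a : R) :
  rho x (a *: v) (a *: v) = a ^+ 2 * rho x v v.
Proof.
have [l1 l2] := metric_bilinear rho x.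
have l1' u := scalar_sum (fun=> a) (fun _ : 'I_1 => v) (l1 u).
have l2' u := scalar_sum (fun=> a) (fun _ : 'I_1 => v) (l2 u).
have := l1' (a *: v); have := l2' v; rewrite !big_ord1 => l2'' ->.
by rewrite l2'' mulrA expr2.
Qed.

Lemma metric_ge0 rho (x : M) (v : tangent x) : 0 <= rho x v v.
Proof.
have [->|v0] := eqVneq v 0; last exact/ltW/metric_positive.
by rewrite -[0 as X in rho x X X](scale0r 0) metric_scale expr0n mul0r.
Qed.

Lemma norm1_ge0 rho U k : (0 <= norm1 rho U k)%E.
Proof. exact: sup_ge0_ge0. Qed.

Lemma norm0_ge U k x : U x -> (`|k x|%:E <= norm0 U k)%E.
Proof. by move=> Ux; apply: le_sup_ge0; exists x. Qed.

(** The defining inequality of a dual norm: homogeneity reduces it to vectors of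
    length [1]. *)
Lemma differential_le_norm1 rho U k (x : M) (v : tangent x) : U x ->
  (`|differential k v|%:E <= (Num.sqrt (rho x v v))%:E * norm1 rho U k)%E.
Proof.
move=> Ux; have [->|v0] := eqVneq v 0.
  have -> : differential k (0 : tangent x) = 0 by exact: linear0.
  by rewrite normr0 mule_ge0// ?norm1_ge0// lee_fin sqrtr_ge0.
have r0 : 0 < rho x v v by exact: metric_positive.
set s := Num.sqrt _; have s0 : 0 < s by rewrite sqrtr_gt0.
have -> : differential k v = s * differential k (s^-1 *: v).
  have -> : differential k (s^-1 *: v) = s^-1 * differential k v.
    exact: linearZ.
  by rewrite mulrA divff ?mul1r// gt_eqF.
rewrite normrM gtr0_norm// EFinM; apply: lee_wpmul2l.
  by rewrite lee_fin ltW.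
apply: (@le_trans _ _ (norm1_at rho x k)); apply: le_sup_ge0; last by exists x.
exists (s^-1 *: v) => //=.
by rewrite metric_scale sqrtrM ?sqr_ge0// sqrtr_sqr gtr0_norm ?invr_gt0//
  mulVf// gt_eqF.
Qed.

Lemma norm1_le rho rho' U k (C : R) : 0 <= C ->
  (forall x (v : tangent x), U x -> rho' x v v <= C * rho x v v) ->
  (norm1 rho U k <= (Num.sqrt C)%:E * norm1 rho' U k)%E.
Proof.
move=> C0 HC.
have b0 : (0 <= (Num.sqrt C)%:E * norm1 rho' U k)%E.
  by rewrite mule_ge0// ?norm1_ge0// lee_fin sqrtr_ge0.
apply: sup_ge0_le => // _ [x Ux <-]; apply: sup_ge0_le => // _ [v /= v1 <-].
apply: (le_trans (differential_le_norm1 rho' k v Ux)).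
apply: lee_wpmul2r; first exact: norm1_ge0.
rewrite lee_fin ler_sqrt//.
apply: (le_trans (HC x v Ux)).
by rewrite -[rho x v v]sqr_sqrtr ?metric_ge0// v1 expr1n mulr1.
Qed.

End Norms.

Lemma closed_ball_compact (R : realType) (d : nat) (y : 'rV[R]_d) (r : R) :
  compact (closed_ball_ Num.norm y r).
Proof.
apply: bounded_closed_compact; last exact: closed_closed_ball_.
exists (`|y| + r); split; first by rewrite num_real.
move=> m hm z /= yz; apply: le_trans (ltW hm).
by rewrite -[z](subKr y); apply: (le_trans (ler_normB _ _)); rewrite lerD2l.
Qed.

Lemma sphere_compact (R : realType) (d : nat) :
  compact [set u : 'rV[R]_d | `|u| = 1].
Proof.
apply: bounded_closed_compact.
  by exists 1; split=> [|m m1 u /= ->]; [rewrite num_real|exact: ltW].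
rewrite (_ : mkset _ = Num.norm @^-1` [set 1]) //.
by apply: (preimage_closed _ (@closed_eq _ _)) => u _; exact: norm_continuous.
Qed.

Section ChartBall.
Context (R : realType) (d : nat) (M : manifold R d) (c : chart R d M).
Hypothesis ac : atlas c.
Local Notation E := 'rV[R]_d.

Lemma cod_closed_ball (y0 : E) : cod c y0 ->
  exists2 r : R, 0 < r & closed_ball_ Num.norm y0 r `<=` cod c.
Proof.
move=> cy; have : nbhs y0 (cod c).
  by apply: open_nbhs_nbhs; split=> //; exact: cod_open.
move=> /nbhs_closedballP[r Hr]; exists r%:num => //.
by rewrite -closed_ballE.
Qed.

(** The inverse image of a coordinate ball: a relatively compact neighbourhood to
    which the hypothesis on the rates applies. *)
Definition chart_ball (y0 : E) (r : R) : set M :=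
  dom c `&` chart_map c @^-1` ball y0 r.

Lemma chart_ball_open y0 r : open (chart_ball y0 r).
Proof.
rewrite openE => x [dx bx]; apply: filterI.
  by apply: open_nbhs_nbhs; split => //; exact: dom_open.
apply: (chart_map_continuous dx); apply: open_nbhs_nbhs; split => //.
exact: ball_open.
Qed.

Lemma closure_chart_ball_compact y0 r : closed_ball_ Num.norm y0 r `<=` cod c ->
  compact (closure (chart_ball y0 r)).
Proof.
move=> rc; pose K := chart_inv c @` closed_ball_ Num.norm y0 r.
have cK : compact K.
  apply: continuous_compact; last exact: closed_ball_compact.
  apply: continuous_in_subspaceT => y /set_mem /rc; exact: chart_inv_continuous.
apply: (subclosed_compact (@closed_closure _ _) cK).
rewrite (closure_id K).1; last exact: compact_closed (@manifold_hausdorff _ _ M) cK.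
apply: closureS => x [dx bx]; exists (chart_map c x); last exact: chart_mapK.
by move: bx; rewrite /= -ball_normE; exact: ltW.
Qed.

Lemma chart_inv_chart_ball y0 r y : closed_ball_ Num.norm y0 r `<=` cod c ->
  ball y0 r y -> chart_ball y0 r (chart_inv c y).
Proof.
move=> rc byr; have cy : cod c y.
  by apply: rc; move: byr; rewrite -ball_normE; exact: ltW.
by split; [exact: chart_inv_dom|rewrite /= chart_invK].
Qed.

End ChartBall.

(** * Comparison of two metrics *)

Section MetricComparison.
Context (R : realType) (d : nat) (M : manifold R d).
Implicit Types (rho : riemannian_metric M) (c : chart R d M).
Local Notation E := 'rV[R]_d.

Lemma continuous_ext (T U : topologicalType) (x : T) (f g : T -> U) :
  f =1 g -> {for x, continuous g} -> {for x, continuous f}.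
Proof. by move=> /funext ->. Qed.

Lemma continuous_at_sum (T : topologicalType) (I : Type) (s : seq I)
    (F : I -> T -> R) (x : T) : (forall i, {for x, continuous (F i)}) ->
  {for x, continuous (fun z => \sum_(i <- s) F i z)}.
Proof.
move=> cF; elim: s => [|i s IH].
  apply: (@continuous_ext _ _ _ _ (fun=> 0)); last exact: cst_continuous.
  by move=> z; rewrite big_nil.
apply: (@continuous_ext _ _ _ _
  (fun z => F i z + \sum_(j <- s) F j z)); last exact: continuousD.
by move=> z; rewrite big_cons.
Qed.

Lemma component_continuous rho c (p : E * E) : atlas c -> cod c p.1 ->
  {for p, continuous (fun p => component rho c p.2 p.2 p.1)}.
Proof.
move=> ac cp.
apply: (@continuous_ext _ _ _ _ (fun q : E * E => \sum_i \sum_j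
    q.2 0 i * q.2 0 j * component rho c 'e_i 'e_j q.1)).
  by move=> q; exact/component_coord/metric_bilinear.
apply: continuous_at_sum => i; apply: continuous_at_sum => j.
have coord l : {for p, continuous (fun q : E * E => q.2 0 l)}.
  apply: (@continuous_comp _ _ _ snd (fun u : E => u 0 l)).
    exact: cvg_snd.
  exact: coord_continuous.
apply: continuousM; first by apply: continuousM; exact: coord.
apply: (@continuous_comp _ _ _ fst (component rho c 'e_i 'e_j)).
  exact: cvg_fst.
exact: (metric_smooth rho ac 'e_i 'e_j 0%N _ cp).
Qed.

Lemma component_scale rho c (y u : E) (a : R) :
  component rho c (a *: u) (a *: u) y = a ^+ 2 * component rho c u u y.
Proof.
have E1 : push c y (a *: u) = a *: push c y u by exact: linearZ.
by rewrite /component E1 metric_scale.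
Qed.

Lemma component_gt0 rho c (y u : E) : atlas c -> cod c y -> u != 0 ->
  0 < component rho c u u y.
Proof.
move=> ac cy u0; apply: metric_positive; apply: contra u0 => /eqP pu.
exact/eqP/(push_eq0 ac cy).
Qed.

(** The quotient of the two quadratic forms is continuous on the product of [K]
    and the unit sphere, hence bounded; homogeneity extends the bound to all
    vectors. *)
Lemma component_comparison rho rho' c (K : set E) : atlas c -> compact K ->
  K `<=` cod c -> exists2 C : R, 0 < C & forall y u, K y ->
    component rho' c u u y <= C * component rho c u u y.
Proof.
move=> ac cK Kc.
have u0 (u : E) : `|u| = 1 -> u != 0 by rewrite -normr_gt0 => ->.
have [|C C0 HC] := @bounded_on_compact R (E * E)%type 'I_1
  (K `*` [set u : E | `|u| = 1])
  (fun _ p => component rho' c p.2 p.2 p.1 / component rho c p.2 p.2 p.1)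
  (compact_setX cK (@sphere_compact R d)).
  move=> _ [y u] /= [Ky /u0 un].
  apply: continuousM; first by apply: component_continuous => //=; exact: Kc.
  apply: (@continuousV _ _ (fun p => component rho c p.2 p.2 p.1)) => /=.
    by rewrite gt_eqF// component_gt0//; exact: Kc.
  by apply: component_continuous => //=; exact: Kc.
exists C => // y u Ky; have [->|un] := eqVneq u 0.
  by rewrite -(scale0r (0 : E)) !component_scale expr0n !mul0r mulr0.
have n0 : `|u| != 0 by rewrite normr_eq0.
have uE : u = `|u| *: (`|u|^-1 *: u) by rewrite scalerA divff// scale1r.
have w1 : `| `|u|^-1 *: u| = 1.
  by rewrite normrZ normfV normr_id mulVf.
suff unit_case (a : R) (v : E) : `|v| = 1 ->
    component rho' c (a *: v) (a *: v) y <=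
    C * component rho c (a *: v) (a *: v) y by rewrite uE; exact: unit_case.
move=> v1; rewrite !component_scale [leRHS]mulrCA; apply: ler_wpM2l.
  exact: sqr_ge0.
rewrite -ler_pdivrMr; last by apply: component_gt0 => //; [exact: Kc|exact: u0].
by apply: le_trans (ler_norm _) _; exact: (HC ord0 (y, v)).
Qed.

(** Charts give the comparison near each point, and compactness gives a common
    constant. *)
Lemma metric_comparison rho rho' (K : set M) : compact K ->
  exists2 C : R, 0 < C & forall x (v : tangent x), K x ->
    rho' x v v <= C * rho x v v.
Proof.
move=> cK; suff H : \forall C \near +oo, K `<=` (fun x =>
    forall v : tangent x, rho' x v v <= C * rho x v v).
  have [C [_ HC]] := H; exists (`|C| + 1) => [|x v Kx].
    by rewrite ltr_wpDl.
  by apply: HC => //; rewrite (le_lt_trans (ler_norm C))// ltrDl.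
move/compact_near_coveringP : cK; apply => x0 _.
set c := chart_at x0; have ac : atlas c by exact: chart_at_atlas.
have dx0 : dom c x0 by exact: chart_at_dom.
have [r r0 rc] := cod_closed_ball (chart_map_cod dx0).
have [C0 C00 HC] := component_comparison rho rho' ac
  (@closed_ball_compact _ _ _ r) rc.
exists (chart_ball c (chart_map c x0) r, [set C | C0 <= C]).
  split; last by apply: nbhs_pinfty_ge; rewrite num_real.
  apply: open_nbhs_nbhs; split; first exact: chart_ball_open.
  by split => //=; exact: ballxx.
move=> [x C] /= [[dx bx] CC].
have cx := chart_map_cod dx; rewrite -[x](chart_mapK dx) => v.
have [u <-] := push_surj ac cx v.
apply: (le_trans (HC (chart_map c x) u _)).
  by move: bx; rewrite /= -ball_normE; exact: ltW.
by rewrite ler_wpM2r// metric_ge0.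
Qed.

Lemma vanishing_rate_metric rho rho' (f g : M -> R) (f_ g_ : nat -> M -> R) :
  vanishing_rate rho f g f_ g_ -> vanishing_rate rho' f g f_ g_.
Proof.
move=> vr U oU cU.
have [C C0 HC] := metric_comparison rho' rho cU.
have sub x : U x -> closure U x by exact: subset_closure.
pose m n := Order.max (norm0 U (f_ n \- f)%R) (norm0 U (g_ n \- g)%R).
have m0 n : (0 <= m n)%E by rewrite le_max sup_ge0_ge0.
have cv : ((Num.sqrt C)%:E * (m n * norm1 rho U (g_ n)))%E @[n --> \oo] --> 0%E.
  by rewrite -[0%E](mule0 (Num.sqrt C)%:E); apply: cvgeZl => //; exact: vr.
apply: (squeeze_cvge _ (cvg_cst 0%E) cv); near=> n; apply/andP; split.
  by apply: mule_ge0; [exact: (m0 n)|exact: norm1_ge0].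
rewrite muleCA; apply: lee_wpmul2l; first exact: (m0 n).
apply: norm1_le; first exact: ltW.
by move=> x v Ux; apply: HC; exact: sub.
Unshelve. all: by end_near. Qed.

End MetricComparison.

(** * Limits of Poisson brackets *)

(** The coordinate fields of [c] have bounded length over [K]. *)
Lemma derive_chart_le_norm1 (R : realType) (d : nat) (M : manifold R d)
    (rho : riemannian_metric M) (c : chart R d M) (U : set M)
    (K : set 'rV[R]_d) : atlas c -> compact K -> K `<=` cod c ->
  exists2 C : R, 0 < C & forall (k : M -> R) j y, smooth k -> K y ->
    U (chart_inv c y) ->
    (`|'D_('e_j) (k \o chart_inv c) y|%:E <= C%:E * norm1 rho U k)%E.
Proof.
move=> ac cK Kc.
have [C C0 HC] := @bounded_on_compact R _ 'I_d K
  (fun j => component rho c 'e_j 'e_j) cK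
  (fun j y Ky => metric_smooth rho ac 'e_j 'e_j 0%N _ (Kc y Ky)).
exists (Num.sqrt C) => [|k j y sk Ky Uy]; first by rewrite sqrtr_gt0.
rewrite -differential_push//; last exact: Kc.
apply: (le_trans (differential_le_norm1 rho k (push c y 'e_j) Uy)).
apply: lee_wpmul2r; first exact: norm1_ge0.
rewrite lee_fin ler_sqrt; last exact: ltW.
exact: le_trans (ler_norm _) (HC j y Ky).
Qed.

(** Near a point, [bracket_limit] applied to
    [v = det W * h - det W * {f, g}], read in a chart, shows that [v]
    vanishes. *)
Lemma poisson_limit (R : realType) (d : nat) (M : manifold R d)
    (w : symplectic_form M) (rho : riemannian_metric M) (f g h : M -> R)
    (f_ g_ : nat -> M -> R) :
  smooth f -> smooth g -> smooth h ->
  (forall n, smooth (f_ n)) -> (forall n, smooth (g_ n)) ->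
  {uniform, g_ @ \oo --> g} ->
  {uniform, (fun n => poisson w (f_ n) (g_ n)) @ \oo --> h} ->
  vanishing_rate rho f g f_ g_ -> poisson w f g = h.
Proof.
move=> sf sg sh sf_ sg_ cg ch vr; apply/funext => x0.
set c := chart_at x0; have ac : atlas c by exact: chart_at_atlas.
have dx0 : dom c x0 by exact: chart_at_dom.
set y0 := chart_map c x0; have cy0 : cod c y0 by exact: chart_map_cod.
have [r r0 rc] := cod_closed_ball cy0.
set K := closed_ball_ _ _ _ in rc; have cK : compact K by exact: closed_ball_compact.
pose O := ball y0 r; pose U := chart_ball c y0 r.
have OK : O `<=` K by move=> y; rewrite /O -ball_normE; exact: ltW.
have Oc : O `<=` cod c by move=> y /OK /rc.
have oO : open O by exact: ball_open.
have Oy0 : O y0 by exact: ballxx.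
have OU y : O y -> U (chart_inv c y) by exact: chart_inv_chart_ball.
have {}vr := vr U (chart_ball_open _ _ _) (closure_chart_ball_compact rc).
pose B i j z := \adj (form_matrix w c z) j i.
pose D z := \det (form_matrix w c z).
pose loc k : 'rV[R]_d -> R := k \o chart_inv c.
have CW i j : Cn_on 1 O (fun z => form_matrix w c z i j).
  exact: Cn_on_sub Oc (form_matrix_smooth w ac i j).
have CD : Cn_on 1 O D by exact: C1_det.
have CB i j : Cn_on 1 O (B i j) by exact: C1_adj.
have aB i j y : O y -> B i j y = - B j i y.
  move=> /Oc cy; have /matrixP/(_ i j) := adj_form_matrix_tr w ac cy.
  by rewrite [LHS]mxE [RHS]mxE.
have Cloc n k : smooth k -> Cn_on n O (loc k).
  by move=> sk; exact: Cn_on_sub Oc (smooth_Cn n sk ac).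
pose v z := D z * loc h z - bracket B (loc f) (loc g) z.
have pE k l y : smooth k -> smooth l -> O y ->
    D y * poisson w k l (chart_inv c y) = bracket B (loc k) (loc l) y.
  by move=> sk sl /Oc cy; exact: poisson_in_chart.
have Cv : {for y0, continuous v}.
  suff : Cn_on 1 O v by move=> /C1_continuous; apply; exact: Oy0.
  apply: (C1D oO (C1M oO CD (Cloc 1%N h sh))).
  apply: (C1N oO); apply: (C1_sum oO) => i; apply: (C1_sum oO) => j.
  apply: (C1M oO (CB i j)); apply: (C1M oO).
    exact: (Cloc 2 f sf).2.
  exact: (Cloc 2 g sg).2.
have [CN CN0 HN] := derive_chart_le_norm1 rho U ac cK rc.
have [CDt CDt0 HD] := @bounded_on_compact R _ 'I_1 K (fun _ => D) cK
  (fun _ y Ky => C1_continuous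
    (C1_det (cod_open (c := c)) (form_matrix_smooth w ac)) (rc y Ky)).
have v0 : v y0 = 0.
  apply: (bracket_limit oO Oy0 CB aB (Cloc 2 f sf) (Cloc 1%N g sg)
    (fun n => Cloc 1%N _ (sf_ n)) (fun n => Cloc 2 _ (sg_ n)) Cv).
  - move=> e e0.
    have : nbhs (0 : \bar R)%E [set a | (a < (e / CN)%:E)%E].
      apply: open_nbhs_nbhs; split; first exact: open_ereal_lt_ereal.
      by rewrite /= lte_fin divr_gt0.
    move=> /vr lt_e; near=> n; move=> y j Oy.
    have /ltW Hn : (Order.max (norm0 U (f_ n \- f)%R) (norm0 U (g_ n \- g)%R)
        * norm1 rho U (g_ n) < (e / CN)%:E)%E by near: n; exact: lt_e.
    rewrite -lee_fin EFinM.
    apply: (@le_trans _ _ (norm0 U (f_ n \- f)%R * (CN%:E * norm1 rho U (g_ n)))%E).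
      apply: lee_pmul; rewrite ?lee_fin//.
        exact: (norm0_ge (f_ n \- f) (OU y Oy)).
      by apply: HN => //; [exact: OK|exact: OU].
    rewrite muleCA -[e](divfK (lt0r_neq0 CN0)) mulrC EFinM.
    apply: lee_wpmul2l; first by rewrite lee_fin ltW.
    apply: le_trans Hn; apply: lee_wpmul2r; first exact: norm1_ge0.
    by rewrite le_max lexx.
  - move=> e e0; have := uniform_cvg_le cg e0.
    by apply: filterS => n Hn y _; exact: Hn.
  - move=> e e0; have := uniform_cvg_le ch (divr_gt0 e0 CDt0).
    apply: filterS => n Hn y Oy.
    rewrite -!pE// /v -pE//.
    rewrite opprB addrA subrK -mulrBr.
    rewrite normrM -[e](divfK (lt0r_neq0 CDt0)) mulrC.
    by apply: ler_pM => //; exact: (HD ord0 y (OK y Oy)).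
have D0 : D y0 != 0.
  by rewrite /D -unitfE -unitmxE; exact: form_matrix_unit.
apply: (mulfI D0); move: v0; rewrite /v -pE// /loc /= /y0 chart_mapK//.
by move/eqP; rewrite subr_eq0 => /eqP.
Unshelve. all: by end_near. Qed.

Theorem theorem1p2p5 (R : realType) (d : nat) (M : manifold R d)
    (omega : symplectic_form M) (f g h : M -> R) (f_ g_ : nat -> M -> R)
    (f_smooth : smooth f) (g_smooth : smooth g) (h_smooth : smooth h)
    (f_n_smooth : forall n, smooth (f_ n))
    (g_n_smooth : forall n, smooth (g_ n))
    (f_cvg : {uniform, f_ @ \oo --> f})
    (g_cvg : {uniform, g_ @ \oo --> g})
    (fg_cvg : {uniform, (fun n => poisson omega (f_ n) (g_ n)) @ \oo --> h}) :
  (forall rho : riemannian_metric M,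
     vanishing_rate rho f g f_ g_ -> poisson omega f g = h) /\
  (forall rho rho' : riemannian_metric M,
     vanishing_rate rho f g f_ g_ <-> vanishing_rate rho' f g f_ g_).
Proof.
split=> [rho|rho rho'].
  exact: (poisson_limit (w := omega)).
by split; exact: vanishing_rate_metric.
Qed.
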